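(* Let $d\ge2$. For any degenerate $f\in\overline{\mathrm{Rat}}_d$ with $f\notin I(d)$ and any probability measure $\mu$ on $\mathbf{P}^1$, we have $\frac{1}{d^n}f^{n*}\mu\to\mu_f$ weakly as $n\to\infty$.
   Context: $\mathbf{P}^1$ is the complex projective line. For $d\ge 1$, $\mathrm{Rat}_d$ is the space of holomorphic maps $\mathbf{P}^1\to\mathbf{P}^1$ of degree $d$. A point of $\overline{\mathrm{Rat}}_d\simeq\mathbf{P}^{2d+1}$ is a pair $f=(P:Q)$ of homogeneous polynomials of degree $d$ in $(z,w)$ with complex coefficients, not both zero, up to a common scalar; $\mathrm{Rat}_d$ is the open subset where $P,Q$ have no common factor. Points of $\overline{\mathrm{Rat}}_d$ not in $\mathrm{Rat}_d$ are called degenerate. Every $f\in\overline{\mathrm{Rat}}_d$ is written $f=H\phi$, with $H=\gcd(P,Q)$ and $\phi=\phi_f=(P/H:Q/H)$ a holomorphic self-map of $\mathbf{P}^1$ of degree $d-\deg H$. The zeros of $H$ in $\mathbf{P}^1$ are the holes of $f$; the multiplicity of such a zero is the depth of the hole. $I(d)\subset\overline{\mathrm{Rat}}_d$ is the set of degenerate $f=H\phi$ such that $\phi$ is constant and its value is one of the holes of $f$. For degenerate $f\notin I(d)$, the iterate $f^n\in\overline{\mathrm{Rat}}_{d^n}$ is the point given by the $n$-fold composition of the polynomial map $F=(P,Q):\mathbf{C}^2\to\mathbf{C}^2$ (this composition is not identically zero); explicitly $f^n=\left(\prod_{k=0}^{n-1}(\phi^{k*}H)^{d^{n-k-1}}\right)\phi^n$,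 where $\phi^{k*}H$ is $H$ composed with the $k$-th iterate of $(P/H,Q/H)$. It is degenerate and not in $I(d^n)$. Pull-back of a measure $\mu$ by a degenerate map $f=H\phi$ with holes $\{h_i\}$ (listed with depth): if $\deg\phi\ne0$, then for continuous $\psi$ on $\mathbf{P}^1$, $\langle f^*\mu,\psi\rangle=\int\sum_{\phi(y)=z}\psi(y)\,d\mu(z)+\sum_i\psi(h_i)$, with preimages counted with multiplicity; if $\deg\phi=0$ and $f\notin I(d)$, $\langle f^*\mu,\psi\rangle=\sum_i\psi(h_i)$. $f^{n*}\mu$ denotes the pull-back of $\mu$ by $f^n$. Measure $\mu_f$ of a degenerate $f$: if $\phi$ is non-constant, $\mu_f=\sum_{n=0}^\infty \frac{1}{d^{n+1}}\sum_i\sum_{\phi^n(z)=h_i}\delta_z$, where the holes $h_i$ and the preimages are counted with multiplicity; if $\phi$ is constant, $\mu_f=\frac1d\sum_i\delta_{h_i}$, holes counted with depth. *)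

(* Defs.v *)
From HB Require Import structures.
From mathcomp Require Import all_boot all_order all_algebra.
From mathcomp Require Import generic_quotient finmap.
From mathcomp Require Import all_classical all_reals all_analysis.
From mathcomp Require Import complex.
(* Only the structures are imported: the notations of mpoly clash with those *)
(* of MathComp-Analysis.                                                     *)
From mathcomp Require Import (canonicals, coercions) mpoly.

Set Implicit Arguments.
Unset Strict Implicit.
Unset Printing Implicit Defensive.

Import Order.TTheory GRing.Theory Num.Theory.
Import numFieldNormedType.Exports.

Local Open Scope classical_set_scope.
Local Open Scope ring_scope.
Local Open Scope quotient_scope.

(* R[i] with the topology given by the modulus *)
HB.instance Definition _ (R : realType) := NormedModule.copy R[i] R[i]^o.

Section ProjectiveLine.
Variable R : realType.
Local Notation C := R[i].

Definition punctured_plane : Type := [set v : C * C | v != (0, 0)].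

HB.instance Definition _ := Choice.on punctured_plane.
HB.instance Definition _ := SubType.on punctured_plane.
HB.instance Definition _ := Topological.on punctured_plane.

Fact e1_neq0 : ((1, 0) : C * C) \in [set v : C * C | v != (0, 0)].
Proof. by rewrite inE/= xpair_eqE oner_eq0. Qed.

HB.instance Definition _ :=
  isPointed.Build punctured_plane (exist _ (1, 0) e1_neq0).

Definition proportional (u v : punctured_plane) : bool :=
  `[< exists2 c : C, c != 0 & \val v = (c * (\val u).1, c * (\val u).2) >].

Fact proportional_is_equiv : equiv_class_of proportional.
Proof.
split=> [u | u v | v u w].
- by apply/asboolP; exists 1; rewrite ?oner_neq0// !mul1r -surjective_pairing.
- by apply/asboolP/asboolP => -[c c0 ->]; exists c^-1; rewrite ?invr_neq0//=;
    rewrite !mulrA mulVf// !mul1r -surjective_pairing.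
- move=> /asboolP[c c0 vE] /asboolP[e e0 wE].
  by apply/asboolP; exists (e * c); rewrite ?mulf_neq0// wE vE/= !mulrA.
Qed.

Canonical proportional_equiv := EquivRelPack proportional_is_equiv.

Definition P1 : Type := quotient_topology {eq_quot proportional}.

HB.instance Definition _ := PointedTopological.on P1.

Definition borelP1 := g_sigma_algebraType (@open P1).

HB.instance Definition _ := Measurable.on borelP1.

(* [v.1 : v.2]; a junk value for v = (0, 0) *)
Definition toP1 (v : C * C) : P1 := \pi_P1 (insubd (point : punctured_plane) v).

Definition hcoord (x : P1) : C * C := \val (repr x).

End ProjectiveLine.

Arguments toP1 {R}.

(* Polynomials in (z, w) with complex coefficients *)
Notation bipoly R := (mpoly.mpoly 2 R[i]).

Section RationalMaps.
Variable R : realType.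
Local Notation C := R[i].
Local Notation bpoly := (bipoly R).

Implicit Types (G H : bpoly) (f g : bpoly * bpoly) (x y : P1 R) (d n : nat).

Definition homogeneous d G : Prop := G \is mpoly.ishomog1 d mpoly.mdeg.

(* mmeasure mdeg is the degree plus one for nonzero polynomials *)
Definition fdeg G : nat := (mpoly.mmeasure mpoly.mdeg G).-1.

Definition eval G (v : C * C) : C :=
  mpoly.meval (fun i : 'I_2 => if i == ord0 then v.1 else v.2) G.

Definition vz : bpoly := mpoly.mpolyX C (mpoly.mnm1 ord0).
Definition vw : bpoly := mpoly.mpolyX C (mpoly.mnm1 ord_max).

Definition divides G H : Prop := exists K, H = G * K.

(* The gcd is unique only up to a nonzero constant; holes, phi, pullback and   *)
(* mu_of below do not depend on the choice of that constant.                   *)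
Definition is_gcd (A B H : bpoly) : Prop :=
  [/\ divides H A, divides H B &
      forall K, divides K A -> divides K B -> divides K H].

Definition gcd (A B : bpoly) : bpoly := xget 0 [set H | is_gcd A B H].

Definition quo (A H : bpoly) : bpoly := xget 0 [set K | A = H * K].

(* The order of vanishing at x of a nonzero form G, i.e. the largest m such    *)
(* that (b z - a w)^m divides G, where x = [a : b]; it is at most fdeg G.      *)
Definition linform x : bpoly := (hcoord x).2 *: vz - (hcoord x).1 *: vw.

Definition mult G x : nat :=
  \max_(m < (fdeg G).+1 | `[< divides (linform x ^+ m) G >]) m.

(* The zeros in P1 of a nonzero form, each repeated as its multiplicity *)
Definition zeros G : seq (P1 R) :=
  flatten [seq nseq (mult G x) x | x <- fset_set [set x | (0 < mult G x)%N]].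

(* (P, Q) represents a point of \overline{Rat}_d; holes, phi, pullback and     *)
(* mu_of do not change when (P, Q) is multiplied by a nonzero constant.        *)
Definition ratbar d f : Prop :=
  [/\ homogeneous d f.1, homogeneous d f.2 & f != (0, 0)].

Definition degenerate f : Prop :=
  exists G, [/\ (0 < fdeg G)%N, divides G f.1 & divides G f.2].

Definition Hpart f : bpoly := gcd f.1 f.2.

Definition phipair f : bpoly * bpoly := (quo f.1 (Hpart f), quo f.2 (Hpart f)).

Definition phi f (x : P1 R) : P1 R :=
  toP1 (eval (phipair f).1 (hcoord x), eval (phipair f).2 (hcoord x)).

Definition phideg d f : nat := (d - fdeg (Hpart f))%N.

Definition holes f : seq (P1 R) := zeros (Hpart f).

Definition phi_constant f : Prop := exists c, forall x, phi f x = c.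

(* Membership in I(d) *)
Definition indeterminate f : Prop :=
  degenerate f /\ exists2 c, (forall x, phi f x = c) & c \in holes f.

(* g \o f, as polynomial self-maps of C^2 *)
Definition compose g f : bpoly * bpoly :=
  (mpoly.comp_mpoly [tuple f.1; f.2] g.1,
   mpoly.comp_mpoly [tuple f.1; f.2] g.2).

Definition iterate n f : bpoly * bpoly := iter n (compose f) (vz, vw).

(* The preimages of y = [a : b] under the self-map (p : q) of P1, where p and  *)
(* q have no common factor: the zeros of b p - a q, with multiplicity.         *)
Definition preimages g y : seq (P1 R) :=
  zeros ((hcoord y).2 *: g.1 - (hcoord y).1 *: g.2).

(* <f^* mu, psi> for f of degree d *)
Definition pullback d f (mu : {measure set (borelP1 R) -> \bar R})
    (psi : P1 R -> R) : R :=
  (if phideg d f != 0%N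
   then \int[mu]_z \sum_(y <- preimages (phipair f) z) psi y else 0)
  + \sum_(h <- holes f) psi h.

Definition dirac_sum (s : seq (P1 R)) : {measure set (borelP1 R) -> \bar R} :=
  msum (fun i => dirac (nth point s i : borelP1 R)) (size s).

Definition mu_nonconstant d f : {measure set (borelP1 R) -> \bar R} :=
  mseries (fun n => mscale ((d%:R ^+ n.+1)^-1)%:nng
    (dirac_sum
      (flatten [seq preimages (iterate n (phipair f)) h | h <- holes f]))) 0.

Definition mu_constant d f : {measure set (borelP1 R) -> \bar R} :=
  mscale (d%:R^-1)%:nng (dirac_sum (holes f)).

Definition mu_of d f : {measure set (borelP1 R) -> \bar R} :=
  if `[< phi_constant f >] then mu_constant d f else mu_nonconstant d f.

(* Weak convergence, for measures given as functionals on continuous functions *)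
Definition weakly_cvg (L : nat -> (P1 R -> R) -> R)
    (nu : {measure set (borelP1 R) -> \bar R}) : Prop :=
  forall psi : P1 R -> R, continuous psi ->
    L n psi @[n --> \oo] --> \int[nu]_x psi x.

End RationalMaps.

(* Main.v *)
From Pilot Require Import Defs.
From HB Require Import structures.
From mathcomp Require Import all_boot all_order all_algebra.
From mathcomp Require Import generic_quotient finmap ring lra.
From mathcomp Require Import all_classical all_reals all_analysis.
From mathcomp Require Import complex measurable_realfun.
From mathcomp Require Import (canonicals, coercions) mpoly.
Import Pilot.Defs.

(** Write f = H phi with phi = (p : q) of degree e < d, p and q without common
    zero, and let (p_n, q_n) be the n-fold composition of (p, q). Composing f
    with f^n = H_n (p_n, q_n) and using that the components of f are homogeneous
    of degree d, one finds

      H_(n+1) = H_n^d * H(p_n, q_n),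

    so that the holes of f^(n+1) are d copies of the holes of f^n together with
    the new holes, i.e. the zeros of H(p_n, q_n). If H = c prod_h (b_h z - a_h w)
    over the holes h = [a_h : b_h], then H(p_n, q_n) is the product of the forms
    b_h p_n - a_h q_n: the new holes are the phi^n-preimages of the holes of f.
    None of these forms vanishes identically, since otherwise phi^n would be
    constant equal to a hole; but either phi is surjective, or it is constant and
    its value is not a hole because f is not in I(d).

    Dividing by d^n, the sum of psi over the holes of f^n is the n-th partial sum
    of the series that defines the integral of psi against mu_f. The rest of the
    pull-back is the integral of a sum of at most e^n values of psi, hence at most
    M e^n, where M bounds |psi| on the compact space P1; after division by d^n it
    tends to 0. When phi is constant, all preimages of the holes under phi^n with
    n > 0 are empty, and the series reduces to its first term, which is the second
    definition of mu_f.

    The algebra rests on linear forms. A linear form b z - a w is prime because it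
    generates the kernel of the restriction to the line spanned by (a, b), a ring
    morphism into an integral domain ([linform_prime]). Since C is algebraically
    closed, nonzero forms are products of linear forms ([homogeneous_splits]), and
    such a product determines multiplicities, zeros, divisors and gcds
    ([mult_splits], [zeros_splits], [dvd_splits], [gcd_no_common_zero]). The
    dynamical part is [iterate_factor], [holes_iterate] and [sum_holes_iterate];
    the analytic part is [continuous_bounded], [le_abs_Rintegral] and
    [cvg_weighted_sums]. *)

Set Implicit Arguments.
Unset Strict Implicit.
Unset Printing Implicit Defensive.

Import Order.TTheory GRing.Theory Num.Theory.
Import numFieldNormedType.Exports.

Local Open Scope classical_set_scope.
Local Open Scope ring_scope.
Local Open Scope quotient_scope.

(** * Polynomials in two variables: substitution, evaluation, homogeneity *)

(** Substitution and evaluation are locked: comparing two of them would otherwise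
    unfold both into sums over monomials. *)
HB.lock Definition subst (R : realType) (g : bipoly R * bipoly R) (G : bipoly R)
  : bipoly R := mpoly.comp_mpoly [tuple g.1; g.2] G.

HB.lock Definition value (R : realType) (G : bipoly R) (v : R[i] * R[i]) : R[i] :=
  eval G v.

Section BivariatePolynomials.
Variable R : realType.
Local Notation C := R[i].
Local Notation bpoly := (bipoly R).
Implicit Types (G K H A B P Q : bpoly) (g f : bpoly * bpoly) (v : C * C) (x y : P1 R).
Local Notation vz := (vz R).
Local Notation vw := (vw R).

Lemma monomialE (m : mpoly.multinom 2) :
  mpoly.mpolyX C m = vz ^+ (m ord0) * vw ^+ (m ord_max).
Proof.
rewrite mpoly.mpolyXE_id big_ord_recl big_ord_recl big_ord0 mulr1.
by congr (_ * mpoly.mpolyX _ (mpoly.mnm1 _) ^+ m _); apply/val_inj.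
Qed.

Lemma mdeg2E (m : mpoly.multinom 2) : mpoly.mdeg m = (m ord0 + m ord_max)%N.
Proof.
rewrite mpoly.mdegE big_ord_recl big_ord_recl big_ord0 addn0.
by congr (_ + m _)%N; apply/val_inj.
Qed.

(** The generators of the polynomial ring as an algebra suffice to check the
    identities between ring morphisms that follow. *)
Lemma bpoly_ind (T : bpoly -> Prop) :
  (forall c, T (mpoly.mpolyC 2 c)) -> T vz -> T vw ->
  (forall G K, T G -> T K -> T (G + K)) -> (forall G K, T G -> T K -> T (G * K)) ->
  forall G, T G.
Proof.
move=> TC Tz Tw TD TM; elim/mpoly.mpolyind => [|c m p _ _ Tp].
  by rewrite -mpoly.mpolyC0.
have TX H n : T H -> T (H ^+ n).
  by move=> TH; elim: n => [|n IH]; rewrite ?expr0 -?mpoly.mpolyC1// exprS; apply: TM.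
apply: TD => //; rewrite -mpoly.mul_mpolyC monomialE.
by apply: (TM _ _ (TC c)); apply: TM; apply: TX.
Qed.

Lemma homogeneous_ind n (T : bpoly -> Prop) :
  T 0 -> (forall G K, T G -> T K -> T (G + K)) -> (forall c G, T G -> T (c *: G)) ->
  (forall i j, (i + j)%N = n -> T (vz ^+ i * vw ^+ j)) ->
  forall G, homogeneous n G -> T G.
Proof.
move=> T0 TD TZ TX G /mpoly.dhomogP hG; rewrite [G]mpoly.mpolyE.
rewrite big_seq; apply: (big_ind T) => // m /hG; rewrite /= mdeg2E => mn.
by apply: TZ; rewrite monomialE; apply: TX.
Qed.

Lemma substM g : {morph subst g : G K / G * K}.
Proof. by move=> G K; rewrite subst.unlock rmorphM. Qed.
Lemma substD g : {morph subst g : G K / G + K}.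
Proof. by move=> G K; rewrite subst.unlock raddfD. Qed.
Lemma substB g : {morph subst g : G K / G - K}.
Proof. by move=> G K; rewrite subst.unlock raddfB. Qed.
Lemma substZ g c G : subst g (c *: G) = c *: subst g G.
Proof. by rewrite subst.unlock mpoly.comp_mpolyZ. Qed.
Lemma substXn g G n : subst g (G ^+ n) = subst g G ^+ n.
Proof. by rewrite subst.unlock rmorphXn. Qed.
Lemma substC g c : subst g (mpoly.mpolyC 2 c) = mpoly.mpolyC 2 c.
Proof. by rewrite subst.unlock mpoly.comp_mpolyC. Qed.
Lemma subst0 g : subst g 0 = 0. Proof. by rewrite subst.unlock raddf0. Qed.
Lemma subst_vz g : subst g vz = g.1.
Proof. by rewrite subst.unlock mpoly.comp_mpolyXU. Qed.
Lemma subst_vw g : subst g vw = g.2.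
Proof. by rewrite subst.unlock mpoly.comp_mpolyXU. Qed.

Lemma valueM v G K : value (G * K) v = value G v * value K v.
Proof. by rewrite value.unlock /eval rmorphM. Qed.
Lemma valueD v G K : value (G + K) v = value G v + value K v.
Proof. by rewrite value.unlock /eval raddfD. Qed.
Lemma valueB v G K : value (G - K) v = value G v - value K v.
Proof. by rewrite value.unlock /eval raddfB. Qed.
Lemma valueZ c G v : value (c *: G) v = c * value G v.
Proof. by rewrite value.unlock /eval mpoly.mevalZ. Qed.
Lemma valueXn v G n : value (G ^+ n) v = value G v ^+ n.
Proof. by rewrite value.unlock /eval rmorphXn. Qed.
Lemma valueC c v : value (mpoly.mpolyC 2 c) v = c.
Proof. by rewrite value.unlock /eval mpoly.mevalC. Qed.
Lemma value0 v : value 0 v = 0. Proof. by rewrite value.unlock /eval raddf0. Qed.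
Lemma value_vz v : value vz v = v.1.
Proof. by rewrite value.unlock /eval mpoly.mevalXU. Qed.
Lemma value_vw v : value vw v = v.2.
Proof. by rewrite value.unlock /eval mpoly.mevalXU. Qed.

Lemma composeE g f : compose g f = (subst f g.1, subst f g.2).
Proof. by rewrite subst.unlock. Qed.

Definition value_pair g v : C * C := (value g.1 v, value g.2 v).

Lemma value_subst g G v : value (subst g G) v = value G (value_pair g v).
Proof.
elim/bpoly_ind: G => [c|||G K IG IK|G K IG IK].
- by rewrite substC !valueC.
- by rewrite subst_vz value_vz.
- by rewrite subst_vw value_vw.
- by rewrite substD !valueD IG IK.
- by rewrite substM !valueM IG IK.
Qed.

Lemma value_pair_compose g f v : value_pair (compose g f) v = value_pair g (value_pair f v).
Proof. by rewrite composeE /value_pair !value_subst. Qed.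

Lemma homogeneous_vz : homogeneous 1 vz.
Proof. by rewrite /homogeneous mpoly.dhomogX; apply/eqP/mpoly.mdeg1. Qed.
Lemma homogeneous_vw : homogeneous 1 vw.
Proof. by rewrite /homogeneous mpoly.dhomogX; apply/eqP/mpoly.mdeg1. Qed.
Lemma homogeneous0 n : homogeneous n (0 : bpoly).
Proof. exact: mpoly.dhomog0. Qed.
Lemma homogeneousM m n G K :
  homogeneous m G -> homogeneous n K -> homogeneous (m + n) (G * K).
Proof. exact: mpoly.dhomogM. Qed.
Lemma homogeneousXn m n G : homogeneous m G -> homogeneous (m * n) (G ^+ n).
Proof. exact: mpoly.dhomogMn. Qed.
Lemma homogeneousD n G K :
  homogeneous n G -> homogeneous n K -> homogeneous n (G + K).
Proof. exact: mpoly.dhomogD. Qed.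
Lemma homogeneousZ n c G : homogeneous n G -> homogeneous n (c *: G).
Proof. exact: mpoly.dhomogZ. Qed.
Lemma homogeneousB n G K :
  homogeneous n G -> homogeneous n K -> homogeneous n (G - K).
Proof. by move=> hG hK; rewrite -scaleN1r; apply/homogeneousD/homogeneousZ. Qed.

Lemma homogeneous_subst m n g G : homogeneous m g.1 -> homogeneous m g.2 ->
  homogeneous n G -> homogeneous (m * n) (subst g G).
Proof.
move=> h1 h2; elim/homogeneous_ind => [|H K hH hK|c H hH|i j ij].
- by rewrite subst0; exact: homogeneous0.
- by rewrite substD; apply: homogeneousD.
- by rewrite substZ; apply: homogeneousZ.
- rewrite substM !substXn subst_vz subst_vw -ij mulnDr.
  by apply: homogeneousM; apply: homogeneousXn.
Qed.

Lemma subst_scale n H g G : homogeneous n G ->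
  subst (H * g.1, H * g.2) G = H ^+ n * subst g G.
Proof.
elim/homogeneous_ind => [|A K hA hK|c A hA|i j ij].
- by rewrite !subst0 mulr0.
- by rewrite !substD hA hK mulrDr.
- by rewrite !substZ hA scalerAr.
- by rewrite !substM !substXn !subst_vz !subst_vw -ij !exprMn exprD mulrACA.
Qed.

Lemma value_scale n (c : C) v G : homogeneous n G ->
  value G (c * v.1, c * v.2) = c ^+ n * value G v.
Proof.
elim/homogeneous_ind => [|A K hA hK|e A hA|i j ij].
- by rewrite !value0 mulr0.
- by rewrite !valueD hA hK mulrDr.
- by rewrite !valueZ hA mulrCA.
- by rewrite !valueM !valueXn !value_vz !value_vw -ij !exprMn exprD mulrACA.
Qed.

Lemma homogeneous0E G : homogeneous 0 G -> G = mpoly.mpolyC 2 (value G (0, 0)).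
Proof.
elim/homogeneous_ind => [|A K hA hK|e A hA|i j /eqP].
- by rewrite value0 mpoly.mpolyC0.
- by rewrite valueD mpoly.mpolyCD -hA -hK.
- by rewrite valueZ mpoly.mpolyCM -hA mpoly.mul_mpolyC.
- by rewrite addn_eq0 => /andP[/eqP-> /eqP->]; rewrite !expr0 mulr1 -mpoly.mpolyC1 valueC.
Qed.

(** In the decomposition of K into homogeneous components, G times the component
    of degree i has degree n + i; comparing degrees in G K leaves only i = m. *)
Lemma homogeneous_divr n m G K : G != 0 -> homogeneous n G ->
  homogeneous (n + m) (G * K) -> homogeneous m K.
Proof.
move=> G0 hG hGK; have e : G * K = G * mpoly.pihomog mpoly.mdeg m K.
  rewrite -[LHS](mpoly.pihomog_dE hGK).
  rewrite [X in G * X](mpoly.pihomog_partitionE (leqnn (mpoly.mmeasure mpoly.mdeg K))).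
  rewrite mulr_sumr raddf_sum/=.
  have [mK|Km] := ltnP m (mpoly.mmeasure mpoly.mdeg K).
    rewrite (bigD1 (Ordinal mK))//= big1 ?addr0; first last.
      move=> i im; apply: (@mpoly.pihomog_ne0 _ _ _ (n + i)).
        by apply: contra im; rewrite eqn_add2l => /eqP im; apply/eqP/val_inj.
      exact/homogeneousM/mpoly.pihomogP.
    by rewrite mpoly.pihomog_dE//; exact/homogeneousM/mpoly.pihomogP.
  rewrite big1; last first.
    move=> i _; apply: (@mpoly.pihomog_ne0 _ _ _ (n + i)); last exact/homogeneousM/mpoly.pihomogP.
    by rewrite eqn_add2l neq_ltn (leq_trans (ltn_ord i) Km).
  rewrite mpoly.pihomogE big_seq_cond big_pred0 ?mulr0// => k.
  apply/negP => /andP[/mpoly.mmeasure_mnm_lt kK /eqP km].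
  by move: (kK mpoly.mdeg); rewrite km ltnNge Km.
move/(mulfI G0): e => ->; exact: mpoly.pihomogP.
Qed.

(** * Points of the projective line *)

Lemma hcoord_neq0 x : hcoord x != (0, 0).
Proof. by rewrite /hcoord; case: (repr x) => v /=; rewrite inE. Qed.

Lemma toP1_eq (u v : C * C) : u != (0, 0) -> v != (0, 0) ->
  (toP1 u = toP1 v <-> exists2 c : C, c != 0 & v = (c * u.1, c * u.2)).
Proof.
move=> u0 v0.
have insK w : w != (0, 0) -> \val (insubd (point : punctured_plane R) w) = w.
  by move=> w0; rewrite insubdK// -topredE/= inE.
split.
  by move/eqquotP => /asboolP[c c0]; rewrite !insK//; exists c.
by case=> c c0 e; apply/eqquotP/asboolP; exists c => //; rewrite !insK.
Qed.

Lemma hcoordK : cancel (@hcoord R) toP1.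
Proof.
move=> x; rewrite -[RHS]reprK /toP1; congr (\pi_(P1 R) _).
by apply/val_inj; rewrite insubdK// -topredE/= inE; exact: hcoord_neq0.
Qed.

Lemma hcoord_toP1 v : v != (0, 0) ->
  exists2 c : C, c != 0 & v = (c * (hcoord (toP1 v)).1, c * (hcoord (toP1 v)).2).
Proof.
by move=> v0; apply/(toP1_eq (hcoord_neq0 _) v0); rewrite hcoordK.
Qed.

Lemma P1_nontrivial : exists x y : P1 R, x <> y.
Proof.
have h1 : (1, 0) != (0, 0) :> C * C by rewrite xpair_eqE oner_eq0.
have h2 : (0, 1) != (0, 0) :> C * C by rewrite xpair_eqE oner_eq0 andbF.
exists (toP1 (1, 0)), (toP1 (0, 1)); case/(toP1_eq h1 h2) => c _ [] _ /eqP.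
by rewrite mulr0 oner_eq0.
Qed.

End BivariatePolynomials.

(** * Linear forms, factorization and greatest common divisors *)

Section LinearForms.
Variable R : realType.
Local Notation C := R[i].
Local Notation bpoly := (bipoly R).
Implicit Types (G K L H A B P Q : bpoly) (g f : bpoly * bpoly) (v : C * C) (x y : P1 R).
Local Notation vz := (vz R).
Local Notation vw := (vw R).

Lemma value_linform x v :
  value (linform x) v = (hcoord x).2 * v.1 - (hcoord x).1 * v.2.
Proof. by rewrite /linform valueB !valueZ value_vz value_vw. Qed.

Lemma homogeneous_linform x : homogeneous 1 (linform x).
Proof.
apply: homogeneousB; apply: homogeneousZ; [exact: homogeneous_vz|exact: homogeneous_vw].
Qed.

Lemma value_linform_eq0 x v : v != (0, 0) ->
  value (linform x) v = 0 <-> toP1 v = x.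
Proof.
move=> v0; rewrite value_linform; split => [/eqP|<-]; last first.
  have [c c0 {2 4}->] := hcoord_toP1 v0.
  by rewrite /= mulrCA [X in _ - X]mulrCA [X in c * X - _]mulrC subrr.
rewrite subr_eq0 => /eqP e; rewrite -[RHS]hcoordK.
apply/esym/toP1_eq => //; first exact: hcoord_neq0.
move: e (hcoord_neq0 x) v0; case: (hcoord x) v => a b [s t] /= e.
rewrite !xpair_eqE !negb_and => ab st.
have [a0|a0] := eqVneq a 0.
  move: ab; rewrite a0 eqxx/= => b0; move: e; rewrite a0 mul0r => /eqP.
  rewrite mulf_eq0 (negbTE b0)/= => /eqP s0.
  by exists (t / b); rewrite ?mulr0 ?s0 ?divfK// mulf_neq0 ?invr_eq0//; move: st; rewrite s0 eqxx.
have tE : t = s / a * b by apply: (mulfI a0); rewrite -e mulrA mulrCA divff// mulr1 mulrC.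
exists (s / a); last by rewrite divfK// -tE.
rewrite mulf_neq0 ?invr_eq0//; apply/eqP => s0.
by move: st; rewrite tE s0 mul0r mul0r eqxx.
Qed.

Lemma linform_neq0 x : linform x != 0.
Proof.
apply/eqP => l0; have [y [z]] := P1_nontrivial R; apply.
have all_x t : t = x.
  by rewrite -[t]hcoordK; apply/value_linform_eq0; rewrite ?hcoord_neq0// l0 value0.
by rewrite (all_x y) (all_x z).
Qed.

Lemma subst_const (s t : C) G :
  subst (mpoly.mpolyC 2 s, mpoly.mpolyC 2 t) G = mpoly.mpolyC 2 (value G (s, t)).
Proof.
elim/bpoly_ind: G => [c|||G K IG IK|G K IG IK].
- by rewrite substC valueC.
- by rewrite subst_vz value_vz.
- by rewrite subst_vw value_vw.
- by rewrite substD valueD IG IK mpoly.mpolyCD.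
- by rewrite substM valueM IG IK mpoly.mpolyCM.
Qed.

Lemma dividesD A G K : divides A G -> divides A K -> divides A (G + K).
Proof. by move=> [X ->] [Y ->]; exists (X + Y); rewrite mulrDr. Qed.

Lemma dividesMl A G K : divides A G -> divides A (K * G).
Proof. by move=> [X ->]; exists (K * X); rewrite mulrCA. Qed.

Lemma dividesZ (c : C) A G : c != 0 -> divides A (c *: G) <-> divides A G.
Proof.
move=> c0; split=> [[X e]|[X ->]]; last by exists (c *: X); rewrite scalerAr.
by exists (c^-1 *: X); rewrite -scalerAr -e scalerA mulVf// scale1r.
Qed.

(** Let x = [a : b] and let u be a linear form with u(a, b) = 1. Modulo
    b z - a w one has z = a u and w = b u, so every G is congruent to
    G(a u, b u). This substitution takes its values in an integral domain and its
    kernel is the ideal of b z - a w. *)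
Lemma linform_restriction x : exists2 u : bpoly, u != 0 &
  forall G, divides (linform x) G <->
    subst ((hcoord x).1 *: u, (hcoord x).2 *: u) G = 0.
Proof.
move: (hcoord_neq0 x); set a := (hcoord x).1; set b := (hcoord x).2 => ab.
have [s [t st]] : exists s t : C, s * a + t * b = 1.
  have [a0|a0] := eqVneq a 0.
    exists 0, b^-1; rewrite mul0r add0r mulVf//.
    by move: ab; rewrite [hcoord x]surjective_pairing -/a -/b a0 xpair_eqE eqxx.
  by exists a^-1, 0; rewrite mul0r addr0 mulVf.
have as1 : 1 - a * s = t * b by rewrite -st [a * s]mulrC addrAC subrr add0r.
have bt1 : 1 - b * t = s * a by rewrite -st [b * t]mulrC addrK.
pose u : bpoly := s *: vz + t *: vw.
have u0 : u != 0.
  apply/eqP => /(congr1 (fun G => value G (a, b)))/eqP.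
  by rewrite valueD !valueZ value_vz value_vw st value0 oner_eq0.
exists u => // G.
have cong K : divides (linform x) (K - subst (a *: u, b *: u) K).
  elim/bpoly_ind: K => [c|||K L IK IL|K L IK IL].
  - by rewrite substC subrr; exists 0; rewrite mulr0.
  - rewrite subst_vz; exists (mpoly.mpolyC 2 t); rewrite mulrC mpoly.mul_mpolyC.
    rewrite /linform -/a -/b /u /= scalerBr scalerDr !scalerA opprD addrA.
    by rewrite -{1}[vz]scale1r -scalerBl as1 [a * t]mulrC.
  - rewrite subst_vw; exists (mpoly.mpolyC 2 (- s)); rewrite mulrC mpoly.mul_mpolyC.
    rewrite /linform -/a -/b /u /= scalerBr scalerDr !scalerA opprD addrA.
    rewrite -{1}[vw]scale1r addrAC -scalerBl bt1.
    by rewrite !mulNr !scaleNr opprK [b * s]mulrC addrC.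
  - by rewrite substD opprD addrACA; apply: dividesD.
  - rewrite substM.
    set K' := subst _ K; set L' := subst _ L.
    have -> : K * L - K' * L' = L * (K - K') + K' * (L - L').
      by rewrite !mulrBr [L * K]mulrC [L * K']mulrC addrA subrK.
    by apply: dividesD; apply: dividesMl.
split=> [[K ->]|G0]; last by have := cong G; rewrite G0 subr0.
rewrite substM /linform substB !substZ subst_vz subst_vw !scalerA /=.
by rewrite -/a -/b [b * a]mulrC subrr mul0r.
Qed.

(** An ideal that is the kernel of a morphism into an integral domain is prime. *)
Lemma linform_prime x G K : divides (linform x) (G * K) ->
  divides (linform x) G \/ divides (linform x) K.
Proof.
have [u u0 h] := linform_restriction x; rewrite !h substM => /eqP.
by rewrite mulf_eq0 => /orP[] /eqP; [left|right].
Qed.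

(** For a form, the restriction of [linform_restriction] is u ^+ n times the value
    at (a, b). *)
Lemma linform_dvd n x G : homogeneous n G ->
  divides (linform x) G <-> value G (hcoord x) = 0.
Proof.
move=> hG; have [u u0 ->] := linform_restriction x.
have -> : subst ((hcoord x).1 *: u, (hcoord x).2 *: u) G =
    u ^+ n * mpoly.mpolyC 2 (value G (hcoord x)).
  rewrite [in RHS](surjective_pairing (hcoord x)) -subst_const -subst_scale//=.
  by rewrite ![u * _]mulrC !mpoly.mul_mpolyC.
split=> [/eqP|->]; last by rewrite mpoly.mpolyC0 mulr0.
by rewrite mulf_eq0 expf_eq0 (negbTE u0) andbF/= mpoly.mpolyC_eq0 => /eqP.
Qed.

Lemma linform_dvd_linform x y : divides (linform x) (linform y) -> x = y.
Proof.
move/(linform_dvd x (homogeneous_linform y))/value_linform_eq0.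
by rewrite hcoordK; apply; exact: hcoord_neq0.
Qed.

Lemma linform_exp_Gauss m x G K : ~ divides (linform x) G ->
  divides (linform x ^+ m) (G * K) -> divides (linform x ^+ m) K.
Proof.
move=> xG; elim: m K => [|m IH] K; first by exists K; rewrite expr0 mul1r.
move=> [L e]; have : divides (linform x) (G * K).
  by exists (linform x ^+ m * L); rewrite e exprS mulrA.
case/linform_prime => // -[K' KE]; move: e.
rewrite KE mulrCA exprS -mulrA => /(mulfI (linform_neq0 x)) e.
by have [|M ->] := IH K'; [exists L|exists M; rewrite mulrA].
Qed.

Lemma divisor_const (c : C) G K : c != 0 -> G * K = mpoly.mpolyC 2 c ->
  exists2 e : C, e != 0 & G = mpoly.mpolyC 2 e.
Proof.
move=> c0 e; apply/mpoly.msize_poly1P.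
have GK0 : G * K != 0 by rewrite e mpoly.mpolyC_eq0.
have [G0 K0] : G != 0 /\ K != 0.
  by move: GK0; rewrite mulf_eq0 negb_or => /andP.
have := congr1 (mpoly.mmeasure mpoly.mdeg) e.
rewrite mpoly.msizeM// mpoly.msizeC c0 (mpoly.mpolySpred mpoly.mdeg G0).
rewrite (mpoly.mpolySpred mpoly.mdeg K0) addSn addnS/= => -[] /eqP.
by rewrite addn_eq0 => /andP[/eqP-> _].
Qed.

Definition lprod (s : seq (P1 R)) : bpoly := \prod_(x <- s) linform x.

(** All the forms of interest are handled through the list of their zeros, up to
    order and up to a constant factor. *)
Definition splits G s := exists2 c : C, c != 0 & G = c *: lprod s.

Lemma lprod_cons x s : lprod (x :: s) = linform x * lprod s.
Proof. by rewrite /lprod big_cons. Qed.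

Lemma lprod_neq0 s : lprod s != 0.
Proof.
elim: s => [|x s IH]; first by rewrite /lprod big_nil oner_neq0.
by rewrite lprod_cons mulf_neq0// linform_neq0.
Qed.

Lemma homogeneous_lprod s : homogeneous (size s) (lprod s).
Proof.
elim: s => [|x s IH]; first by rewrite /lprod big_nil; exact: mpoly.dhomog1.
by rewrite lprod_cons; apply: (homogeneousM (homogeneous_linform x) IH).
Qed.

Lemma splits_neq0 G s : splits G s -> G != 0.
Proof.
by case=> c c0 ->; rewrite -mpoly.mul_mpolyC mulf_neq0 ?lprod_neq0 ?mpoly.mpolyC_eq0.
Qed.

Lemma splits_homogeneous G s : splits G s -> homogeneous (size s) G.
Proof. by case=> c c0 ->; apply/homogeneousZ/homogeneous_lprod. Qed.

Lemma splits_cons x G s : splits G s -> splits (linform x * G) (x :: s).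
Proof. by case=> c c0 ->; exists c => //; rewrite lprod_cons scalerAr. Qed.

Lemma splitsM G K s t : splits G s -> splits K t -> splits (G * K) (s ++ t).
Proof.
move=> [c c0 ->] [e e0 ->]; exists (c * e); first by rewrite mulf_neq0.
by rewrite /lprod big_cat/= -scalerAl -scalerAr scalerA.
Qed.

Lemma splits1 : splits 1 [::].
Proof. by exists 1; rewrite ?oner_neq0// /lprod big_nil scale1r. Qed.

Lemma splitsZ (c : C) G s : c != 0 -> splits G s -> splits (c *: G) s.
Proof. by move=> c0 [e e0 ->]; exists (c * e); rewrite ?mulf_neq0// scalerA. Qed.

Lemma splitsXn G s n : splits G s -> splits (G ^+ n) (flatten (nseq n s)).
Proof.
move=> Gs; elim: n => [|n IH]; first by rewrite expr0; exact: splits1.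
by rewrite exprS; apply: splitsM.
Qed.

Lemma fdeg_homogeneous n G : G != 0 -> homogeneous n G -> fdeg G = n.
Proof.
move=> G0 hG; apply: (mpoly.dhomog_uniq G0 _ hG); exact: mpoly.dhomog_msize hG.
Qed.

(** Unique factorization, in the only case that is needed: by primality, a linear
    form can only be cancelled against equal factors. *)
Lemma linform_exp_dvd m x G s : splits G s ->
  divides (linform x ^+ m) G <-> (m <= count_mem x s)%N.
Proof.
case=> c c0 ->; rewrite dividesZ//; elim: s m {G c c0} => [|y s IH] m.
  rewrite leqn0; case: m => [|m].
    by rewrite expr0 eqxx; split=> // _; exists (lprod [::]); rewrite mul1r.
  split=> // -[K]; rewrite /lprod big_nil exprS => /(congr1 (fun G => value G (hcoord x)))/eqP.
  rewrite -mpoly.mpolyC1 valueC !valueM.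
  have -> : value (linform x) (hcoord x) = 0.
    by apply/value_linform_eq0; [exact: hcoord_neq0|exact: hcoordK].
  by rewrite !mul0r oner_eq0.
rewrite lprod_cons /=; have [->|yx] := eqVneq y x.
  rewrite add1n; case: m => [|m].
    by split=> // _; exists (linform x * lprod s); rewrite expr0 mul1r.
  rewrite ltnS -IH exprS; split=> [[K]|[K ->]]; last by exists K; rewrite mulrA.
  by rewrite -mulrA => /(mulfI (linform_neq0 x)) ->; exists K.
rewrite add0n -IH; split; last exact: dividesMl.
by apply: linform_exp_Gauss => /linform_dvd_linform xy; rewrite xy eqxx in yx.
Qed.

Lemma mult_splits x G s : splits G s -> mult G x = count_mem x s.
Proof.
move=> Gs; have Gs' := fdeg_homogeneous (splits_neq0 Gs) (splits_homogeneous Gs).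
apply/eqP; rewrite eqn_leq; apply/andP; split.
  by apply/bigmax_leqP => i /asboolP/(linform_exp_dvd _ _ Gs).
have cs : (count_mem x s < (fdeg G).+1)%N by rewrite Gs' ltnS count_size.
by apply: (@bigop.bigmax_sup _ (Ordinal cs)) => //; apply/asboolP/(linform_exp_dvd _ _ Gs).
Qed.

Lemma zeros_splits G s : splits G s -> perm_eq (zeros G) s.
Proof.
move=> Gs; have setE : [set x | (0 < mult G x)%N] = [set` s].
  by apply/seteqP; split=> x /=; rewrite (mult_splits x Gs) -has_count has_pred1.
rewrite /zeros setE; apply/allP => y _ /=; apply/eqP.
set r := fset_set _; have ry : (y \in (r : seq _)) = (y \in s).
  by apply/idP/idP; rewrite in_fset_set ?inE//; exact: finite_seq.
rewrite count_flatten -map_comp sumnE big_map.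
under eq_bigr => x _ do rewrite /= count_nseq/= (mult_splits x Gs).
have [ys|ys] := boolP (y \in s).
  rewrite (bigD1_seq y) ?ry ?fset_uniq//= eqxx mul1n big1.
    by rewrite addn0.
  by move=> x /negbTE ->.
transitivity 0%N; last by apply/esym/count_memPn.
rewrite big_seq big1//.
move=> x xr.
have [xy|//] := eqVneq x y.
by move: xr; rewrite xy ry (negbTE ys).
Qed.

Lemma zeros0 : zeros (0 : bpoly) = [::].
Proof.
have fdeg0 : fdeg (0 : bpoly) = 0%N by rewrite /fdeg mpoly.mmeasure0.
rewrite /zeros; have -> : [set x | (0 < mult (0%R : bpoly) x)%N] = set0; last by rewrite fset_set0.
apply/seteqP; split=> // x /=; rewrite lt0n => /eqP; apply; apply/eqP.
rewrite -leqn0; apply/bigmax_leqP => -[i /=]; rewrite fdeg0 ltnS => ->; done.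
Qed.

(** The divisor K ranges over all polynomials, as in the definition of a gcd. Each
    linear factor of G = K L divides K or L, and once all of them are cancelled,
    K has degree 0. *)
Lemma dvd_splits G K s : splits G s -> divides K G -> exists t, splits K t.
Proof.
move=> [c c0 ->] [L]; elim: s K L c c0 => [|x s IH] K L c c0.
  rewrite /lprod big_nil -mpoly.mul_mpolyC mulr1 => /esym/divisor_const[]// e e0 ->.
  by exists [::], e; rewrite // /lprod big_nil -mpoly.mul_mpolyC mulr1.
rewrite lprod_cons => e.
have : divides (linform x) (K * L) by rewrite -e scalerAr; exists (c *: lprod s).
case/linform_prime => -[M ME]; move: e; rewrite ME scalerAr ?[K * _]mulrCA -?mulrA;
    move=> /(mulfI (linform_neq0 x)) /IH[]// t st.
  by exists (x :: t); exact: splits_cons.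
by exists t.
Qed.

(** Either G(1, 0) = 0, or G(t, 1) is a polynomial of degree n + 1 in t, which has
    a root. *)
Lemma homogeneous_zero n G : homogeneous n.+1 G ->
  exists x, value G (hcoord x) = 0.
Proof.
move=> hG.
suff [v v0 Gv] : exists2 v, v != (0, 0) & value G v = 0.
  exists (toP1 v); have [c c0 vE] := hcoord_toP1 v0.
  have := value_scale c (hcoord (toP1 v)) hG; rewrite -vE Gv => /esym/eqP.
  by rewrite mulf_eq0 expf_eq0 (negbTE c0) andbF/= => /eqP.
(* p is G(t, 1), and its coefficient of degree n + 1 is G(1, 0). *)
pose T (p : {poly C}) H :=
  (size p <= n.+2)%N /\ (forall t : C, value H (t, 1) = p.[t]) /\
  value H (1, 0) = p`_n.+1.
have [p [sp [pE p0]]] : exists p, T p G.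
  elim/homogeneous_ind: hG => [|A B [p [pn [pA p0]]] [q [qn [qB q0]]]
      |c A [p [pn [pA p0]]]|i j ij].
  - by exists 0; rewrite /T size_poly0 coef0 value0; split=> //; split=> // t; rewrite horner0 value0.
  - exists (p + q); split; first by rewrite (leq_trans (size_polyD _ _))// geq_max pn qn.
    by split=> [t|]; rewrite ?hornerD ?coefD valueD ?pA ?qB ?p0 ?q0.
  - exists (c *: p); split; first exact: leq_trans (size_scale_leq _ _) pn.
    by split=> [t|]; rewrite ?hornerZ ?coefZ valueZ ?pA ?p0.
  - exists 'X^i; split; first by rewrite size_polyXn ltnS -ij leq_addr.
    split=> [t|]; first by rewrite hornerXn valueM !valueXn value_vz value_vw expr1n mulr1.
    rewrite coefXn valueM !valueXn value_vz value_vw expr1n mul1r expr0n/=.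
    by have -> : (n.+1 == i) = (j == 0)%N by rewrite -ij -[X in _ == X]addn0 eqn_add2l.
have [pn|pn] := eqVneq p`_n.+1 0.
  by exists (1, 0); [rewrite xpair_eqE oner_eq0|rewrite p0 pn].
have p1 : size p != 1.
  apply/eqP => sp1; move: pn; rewrite nth_default ?eqxx// sp1//.
have /closed_rootP[t /rootP pt] := p1.
by exists (t, 1); [rewrite xpair_eqE oner_eq0 andbF|rewrite pE].
Qed.

Lemma homogeneous_splits n G : G != 0 -> homogeneous n G ->
  exists2 s, size s = n & splits G s.
Proof.
elim: n G => [|n IH] G G0 hG.
  exists [::] => //; exists (value G (0, 0)).
    by apply: contra G0 => /eqP e; rewrite (homogeneous0E hG) e mpoly.mpolyC0.
  by rewrite {1}(homogeneous0E hG) /lprod big_nil -mpoly.mul_mpolyC mulr1.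
have [x /(linform_dvd x hG)[K GE]] := homogeneous_zero hG.
move: G0 hG; rewrite GE mulf_eq0 negb_or => /andP[x0 K0] hG.
have [s sn Ks] := IH K K0 (homogeneous_divr x0 (homogeneous_linform x) hG).
by exists (x :: s); rewrite /= ?sn//; apply: splits_cons.
Qed.

Lemma size_zeros n G : homogeneous n G -> (size (zeros G) <= n)%N.
Proof.
move=> hG; have [->|G0] := eqVneq G 0; first by rewrite zeros0.
by have [s <- /zeros_splits/perm_size->] := homogeneous_splits G0 hG.
Qed.

Lemma splits_zeros n G : G != 0 -> homogeneous n G -> splits G (zeros G).
Proof.
move=> G0 hG; have [s _ Gs] := homogeneous_splits G0 hG.
have [c c0 {1}->] := Gs; exists c => //; congr (_ *: _).
by apply: perm_big; rewrite perm_sym; exact: zeros_splits.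
Qed.

Lemma mem_zeros n G x : G != 0 -> homogeneous n G ->
  x \in zeros G <-> value G (hcoord x) = 0.
Proof.
move=> G0 hG; have Gs := splits_zeros G0 hG.
rewrite -(linform_dvd x hG) -[linform x]expr1 (linform_exp_dvd _ _ Gs).
by rewrite -has_count has_pred1.
Qed.

Definition no_common_zero g := forall x, value_pair g (hcoord x) != (0, 0).

(** A common divisor K of H P and H Q is a product of linear forms. Each of them
    divides H, as it cannot divide both P and Q, and can be cancelled. *)
Lemma is_gcd_no_common_zero m n H P Q : H != 0 -> homogeneous m H ->
  homogeneous n P -> homogeneous n Q -> no_common_zero (P, Q) -> is_gcd (H * P) (H * Q) H.
Proof.
move=> H0 hH hP hQ PQ; split; [by exists P|by exists Q|move=> K KP KQ].
have [t [c c0 KE]] : exists t, splits K t.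
  have [HP0|HP0] := eqVneq (H * P) 0; last first.
    have [s _ /dvd_splits/(_ KP)//] := homogeneous_splits HP0 (homogeneousM hH hP).
  have [HQ0|HQ0] := eqVneq (H * Q) 0; last first.
    have [s _ /dvd_splits/(_ KQ)//] := homogeneous_splits HQ0 (homogeneousM hH hQ).
  move/eqP: HP0; move/eqP: HQ0; rewrite !mulf_eq0 (negbTE H0)/= => /eqP Q0 /eqP P0.
  by have := PQ (toP1 (1, 0)); rewrite /value_pair /= P0 Q0 !value0 eqxx.
rewrite KE in KP KQ *; elim: t H {H0 hH K KE} KP KQ => [|x t IH] H.
  move=> _ _; exists (c^-1 *: H).
  by rewrite /lprod big_nil -scalerAl -scalerAr scalerA divff// scale1r mul1r.
rewrite lprod_cons scalerAr => -[A eA] [B eB].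
have xH : divides (linform x) H.
  have /linform_prime[//|xP] : divides (linform x) (H * P).
    by rewrite eA -mulrA; exists (c *: lprod t * A).
  have /linform_prime[//|xQ] : divides (linform x) (H * Q).
    by rewrite eB -mulrA; exists (c *: lprod t * B).
  have /negP[] := PQ x; rewrite /value_pair /=; apply/eqP; congr (_, _).
    exact/(linform_dvd x hP).
  exact/(linform_dvd x hQ).
have [H' HE] := xH; move: eA eB; rewrite HE -!mulrA.
move=> /(mulfI (linform_neq0 x)) eA /(mulfI (linform_neq0 x)) eB.
by have [||L ->] := IH H'; [exists A|exists B|exists L; rewrite mulrA].
Qed.

Lemma gcd_no_common_zero m n H P Q : H != 0 -> homogeneous m H ->
  homogeneous n P -> homogeneous n Q -> no_common_zero (P, Q) ->
  exists2 c : C, c != 0 & Defs.gcd (H * P) (H * Q) = c *: H.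
Proof.
move=> H0 hH hP hQ PQ; have gH := is_gcd_no_common_zero H0 hH hP hQ PQ.
have [gA gB gM] : is_gcd (H * P) (H * Q) (Defs.gcd (H * P) (H * Q)).
  by rewrite /Defs.gcd; case: xgetP => // /(_ H).
have [H1 H2 HM] := gH.
have [K KE] := gM _ H1 H2; have [L LE] := HM _ gA gB.
have /divisor_const[] : K * L = mpoly.mpolyC 2 1.
  apply: (mulfI H0); rewrite mulrA -KE -LE mpoly.mpolyC1 mulr1//.
  exact: oner_neq0.
by move=> c c0 Kc; exists c => //; rewrite KE Kc mulrC mpoly.mul_mpolyC.
Qed.

Lemma quoMK H K : H != 0 -> quo (H * K) H = K.
Proof.
move=> H0; rewrite /quo; case: xgetP => [L _ /= /(mulfI H0)//|/(_ K)[]//].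
Qed.

(** As long as the two components have a common zero, divide both by the
    corresponding linear form. *)
Lemma homogeneous_decomposition d f : ratbar d f ->
  exists m n H P Q, [/\ (m + n)%N = d, H != 0, homogeneous m H & 
   [/\ homogeneous n P, homogeneous n Q, no_common_zero (P, Q) & f = (H * P, H * Q)]].
Proof.
elim: d f => [|d IH] [A B] [/= hA hB f0].
  exists 0%N, 0%N, 1, A, B; split=> //; first exact: oner_neq0; first exact: mpoly.dhomog1.
  split=> //; last by rewrite !mul1r.
  move=> x; apply: contra f0; rewrite /value_pair /= (homogeneous0E hA) (homogeneous0E hB).
  by rewrite !valueC => /eqP[-> ->]; rewrite mpoly.mpolyC0.
have [AB|] := pselect (no_common_zero (A, B)).
  exists 0%N, d.+1, 1, A, B; split=> //; first exact: oner_neq0; first exact: mpoly.dhomog1.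
  by split=> //; rewrite !mul1r.
move/existsNP => [x /negP]; rewrite negbK /value_pair /= => /eqP[].
move=> /(linform_dvd x hA)[A' AE] /(linform_dvd x hB)[B' BE].
have [|m [n [H [P [Q [mn H0 hH [hP hQ PQ [A'E B'E]]]]]]]] := IH (A', B').
  have hx := homogeneous_linform x; have x0 := linform_neq0 x.
  split=> /=; first by apply: (homogeneous_divr x0 hx); rewrite -AE.
    by apply: (homogeneous_divr x0 hx); rewrite -BE.
  by apply: contra f0 => /eqP[A0 B0]; rewrite AE BE A0 B0 mulr0.
exists m.+1, n, (linform x * H), P, Q; split=> //.
- by rewrite addSn mn.
- by rewrite mulf_neq0 ?linform_neq0.
- exact: (homogeneousM (homogeneous_linform x) hH).
- by split=> //; rewrite AE BE A'E B'E !mulrA.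
Qed.

End LinearForms.

(** * Self-maps of the projective line *)

Section SelfMaps.
Variable R : realType.
Local Notation C := R[i].
Local Notation bpoly := (bipoly R).
Implicit Types (G K L H A B P Q : bpoly) (g f : bpoly * bpoly) (v : C * C) (x y h : P1 R).
Local Notation vz := (vz R).
Local Notation vw := (vw R).

Lemma Hpart_phipair m n H P Q : H != 0 -> homogeneous m H ->
  homogeneous n P -> homogeneous n Q -> no_common_zero (P, Q) ->
  exists2 c : C, c != 0 & Hpart (H * P, H * Q) = c *: H /\
    phipair (H * P, H * Q) = (c^-1 *: P, c^-1 *: Q).
Proof.
move=> H0 hH hP hQ PQ; have [c c0 gE] := gcd_no_common_zero H0 hH hP hQ PQ.
exists c => //; rewrite /phipair /Hpart /= gE; split=> //.
have cH0 : c *: H != 0 by rewrite -mpoly.mul_mpolyC mulf_neq0 ?mpoly.mpolyC_eq0.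
have E K : H * K = (c *: H) * (c^-1 *: K).
  by rewrite -scalerAl -scalerAr scalerA divff// scale1r.
by rewrite !E !(quoMK _ cH0).
Qed.

Lemma no_common_zeroZ c P Q : c != 0 -> no_common_zero (P, Q) -> no_common_zero (c *: P, c *: Q).
Proof.
move=> c0 PQ x; apply: contra (PQ x); rewrite /value_pair /= !valueZ !xpair_eqE.
by rewrite !mulf_eq0 (negbTE c0).
Qed.

Lemma ratbarP d f : ratbar d f -> exists m e, [/\ (m + e)%N = d,
  Hpart f != 0, homogeneous m (Hpart f) &
  [/\ homogeneous e (phipair f).1, homogeneous e (phipair f).2, no_common_zero (phipair f) &
   f = (Hpart f * (phipair f).1, Hpart f * (phipair f).2)]].
Proof.
move=> /homogeneous_decomposition[m [e [H [P [Q [me H0 hH [hP hQ PQ ->]]]]]]].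
have [c c0 [-> ->]] := Hpart_phipair H0 hH hP hQ PQ.
exists m, e; split=> //=; first by rewrite -mpoly.mul_mpolyC mulf_neq0 ?mpoly.mpolyC_eq0.
  exact: homogeneousZ.
split; [exact: homogeneousZ|exact: homogeneousZ|by apply: no_common_zeroZ; rewrite ?invr_eq0|].
by rewrite -!scalerAl -!scalerAr !scalerA divff// !scale1r.
Qed.

(** A common factor of positive degree divides H, which is then not constant. *)
Lemma degenerate_Hpart m f : Hpart f != 0 -> homogeneous m (Hpart f) ->
  is_gcd f.1 f.2 (Hpart f) -> degenerate f -> (0 < m)%N.
Proof.
move=> H0 hH [_ _ gM] [G [G0 G1 G2]]; have [K HE] := gM G G1 G2.
rewrite lt0n; apply/eqP => m0; move: hH H0; rewrite m0 => /homogeneous0E HC.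
rewrite HC mpoly.mpolyC_eq0 => c0.
have [|e e0 GE] := @divisor_const _ _ G K c0; first by rewrite -HC HE.
by move: G0; rewrite /fdeg GE mpoly.mmeasureC e0.
Qed.

Definition mapP1 g x : P1 R := toP1 (value_pair g (hcoord x)).

Lemma phiE f : phi f = mapP1 (phipair f).
Proof. by apply/funext => x; rewrite /mapP1 /value_pair value.unlock. Qed.

Lemma value_pair_neq0 n g v : homogeneous n g.1 -> homogeneous n g.2 -> no_common_zero g ->
  v != (0, 0) -> value_pair g v != (0, 0).
Proof.
move=> h1 h2 g0 v0; have [c c0 ->] := hcoord_toP1 v0.
rewrite /value_pair !(value_scale _ _ h1, value_scale _ _ h2).
rewrite xpair_eqE !mulf_eq0 expf_eq0 (negbTE c0) andbF/=.
by move: (g0 (toP1 v)); rewrite xpair_eqE.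
Qed.

Lemma mapP1_toP1 n g v : homogeneous n g.1 -> homogeneous n g.2 -> no_common_zero g ->
  v != (0, 0) -> mapP1 g (toP1 v) = toP1 (value_pair g v).
Proof.
move=> h1 h2 g0 v0; have gv := value_pair_neq0 h1 h2 g0 v0.
apply/toP1_eq => //.
have [c c0 vE] := hcoord_toP1 v0; exists (c ^+ n); first by rewrite expf_neq0.
by rewrite {1}vE /value_pair !(value_scale _ _ h1, value_scale _ _ h2).
Qed.

Lemma iterateS n g : iterate n.+1 g = compose g (iterate n g).
Proof. by []. Qed.

Lemma value_pair_iterateS n g v :
  value_pair (iterate n.+1 g) v = value_pair g (value_pair (iterate n g) v).
Proof. by rewrite iterateS value_pair_compose. Qed.

Lemma homogeneous_iterate e g n : homogeneous e g.1 -> homogeneous e g.2 ->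
  homogeneous (e ^ n) (iterate n g).1 /\ homogeneous (e ^ n) (iterate n g).2.
Proof.
move=> h1 h2; elim: n => [|n [IH1 IH2]].
  by split; [exact: homogeneous_vz|exact: homogeneous_vw].
by rewrite iterateS composeE expnSr; split; apply: homogeneous_subst.
Qed.

Lemma no_common_zero_iterate e g n : homogeneous e g.1 -> homogeneous e g.2 ->
  no_common_zero g -> no_common_zero (iterate n g).
Proof.
move=> h1 h2 g0 x; elim: n => [|n IH].
  by rewrite /value_pair value_vz value_vw -surjective_pairing hcoord_neq0.
by rewrite value_pair_iterateS; exact: value_pair_neq0 h1 h2 g0 IH.
Qed.

Lemma mapP1_iterate e g n x : homogeneous e g.1 -> homogeneous e g.2 ->
  no_common_zero g -> mapP1 (iterate n g) x = iter n (mapP1 g) x.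
Proof.
move=> h1 h2 g0; elim: n => [|n IH] /=.
  by rewrite /mapP1 /value_pair value_vz value_vw -surjective_pairing hcoordK.
rewrite -IH /mapP1 -/(mapP1 g _) (mapP1_toP1 h1 h2 g0) ?value_pair_iterateS//.
exact: (no_common_zero_iterate _ h1 h2 g0).
Qed.

(** The form whose zeros are the preimages of y under g. *)
Definition fibre_form g y : bpoly := (hcoord y).2 *: g.1 - (hcoord y).1 *: g.2.

Lemma fibre_formE g y : fibre_form g y = subst g (linform y).
Proof. by rewrite /linform substB !substZ subst_vz subst_vw. Qed.

Lemma homogeneous_fibre_form n g y : homogeneous n g.1 -> homogeneous n g.2 ->
  homogeneous n (fibre_form g y).
Proof. by move=> h1 h2; apply: homogeneousB; apply: homogeneousZ. Qed.

Lemma value_fibre_form g x y : no_common_zero g ->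
  value (fibre_form g y) (hcoord x) = 0 <-> mapP1 g x = y.
Proof. by move=> g0; rewrite fibre_formE value_subst value_linform_eq0//; exact: g0. Qed.

Lemma mem_preimages n g x y : homogeneous n g.1 -> homogeneous n g.2 -> no_common_zero g ->
  fibre_form g y != 0 -> x \in preimages g y <-> mapP1 g x = y.
Proof.
move=> h1 h2 g0 y0; rewrite -(value_fibre_form _ _ g0).
exact: mem_zeros y0 (homogeneous_fibre_form _ h1 h2).
Qed.

Lemma size_preimages n g y : homogeneous n g.1 -> homogeneous n g.2 ->
  (size (preimages g y) <= n)%N.
Proof. by move=> h1 h2; apply/size_zeros/homogeneous_fibre_form. Qed.

Lemma splits_preimages n g y : homogeneous n g.1 -> homogeneous n g.2 ->
  fibre_form g y != 0 -> splits (fibre_form g y) (preimages g y).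
Proof. by move=> h1 h2 y0; apply: splits_zeros y0 (homogeneous_fibre_form _ h1 h2). Qed.

(** Substituting g in the linear form of a zero y of H gives the fibre form over
    y. *)
Lemma splits_subst n g H s : homogeneous n g.1 -> homogeneous n g.2 ->
  splits H s -> {in s, forall y, fibre_form g y != 0} ->
  splits (subst g H) (flatten [seq preimages g y | y <- s]).
Proof.
move=> h1 h2 [c c0 ->] sg; rewrite substZ; apply: splitsZ => //.
elim: s sg => [|y s IH] sg.
  rewrite /lprod big_nil -mpoly.mpolyC1 substC mpoly.mpolyC1; exact: splits1.
rewrite lprod_cons substM -fibre_formE /=; apply: splitsM.
  by apply: splits_preimages h1 h2 _; apply: sg; rewrite mem_head.
by apply: IH => z zs; apply: sg; rewrite in_cons zs orbT.
Qed.

(** The fibre form over y has positive degree, so it has a zero; in degree 0 the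
    map is constant. *)
Lemma mapP1_surjective e g : homogeneous e g.1 -> homogeneous e g.2 -> no_common_zero g ->
  ~ (exists c, forall x, mapP1 g x = c) -> forall y, exists x, mapP1 g x = y.
Proof.
move=> h1 h2 g0 nc y; case: e h1 h2 => [|e] h1 h2; last first.
  have [x] := homogeneous_zero (homogeneous_fibre_form y h1 h2).
  by move/(value_fibre_form _ _ g0); exists x.
exfalso; apply: nc; exists (mapP1 g (toP1 (1, 0))) => x; rewrite /mapP1 /value_pair.
by rewrite (homogeneous0E h1) (homogeneous0E h2) !valueC.
Qed.

End SelfMaps.

(** * Continuous functions on the projective line *)

Section Boundedness.
Variable R : realType.
Local Notation C := R[i].
Local Open Scope complex_scope.

Lemma complex_continuous : continuous (fun p : R * R => p.1 +i* p.2 : C).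
Proof.
move=> [s t] /=; apply/cvgrPdist_lt => e e0.
have /andP[/eqP/= Ie Re0] : (complex.Im e == 0) && (0 < complex.Re e) by rewrite ltcE in e0.
have e2 : 0 < complex.Re e / 2 by rewrite divr_gt0.
have H : \forall p \near nbhs (s, t), `|s - p.1| < complex.Re e / 2 /\ `|t - p.2| < complex.Re e / 2.
  exists (ball s (complex.Re e / 2), ball t (complex.Re e / 2)).
    by split; exact: nbhsx_ballx.
  by move=> [u v] /= [].
apply: filterS H => -[u v] /= [su tv].
have -> : e = (complex.Re e)%:C by rewrite [LHS]complexE Ie mulr0 addr0.
rewrite normc_def /= ltcR -(gtr0_norm Re0) -sqrtr_sqr ltr_sqrt ?exprn_gt0//.
move: su tv; rewrite -(real_normK (num_real (s - u))) -(real_normK (num_real (t - v))).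
by move: (normr_ge0 (s - u)) (normr_ge0 (t - v)); nra.
Qed.

Lemma continuous_toP1 (X : topologicalType) (w : X -> C * C) :
  continuous w -> (forall v, w v != (0, 0)) -> continuous (toP1 \o w).
Proof.
move=> cw w0.
have w0' v : w v \in [set v : C * C | v != (0, 0)] by rewrite inE; exact: w0.
pose k v : punctured_plane R := exist _ (w v) (w0' v).
have ck : continuous k by apply: continuous_comp_initial.
have -> : toP1 \o w = (\pi_(P1 R) : punctured_plane R -> P1 R) \o k.
  apply/funext => v /=; rewrite /toP1; congr (\pi_(P1 R) _).
  by apply/val_inj; rewrite insubdK// -topredE.
move=> v; apply: continuous_comp; [exact: ck|exact: pi_continuous].
Qed.

(** The unit disc lies in a square, which is a product of compact intervals. *)
Lemma bounded_on_square (psi : P1 R -> R) (w : R * R -> C * C) :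
  continuous psi -> continuous w -> (forall v, w v != (0, 0)) ->
  exists2 M : R, 0 <= M & forall s t : R, s ^+ 2 + t ^+ 2 <= 1 ->
    `|psi (toP1 (w (s, t)))| <= M.
Proof.
move=> cpsi cw w0; pose g := psi \o (toP1 \o w).
have cg : continuous g.
  by move=> p; apply: continuous_comp; [exact: continuous_toP1|exact: cpsi].
have cK : compact (`[-1 : R, 1]%classic `*` `[-1 : R, 1]%classic).
  by apply: compact_setX; exact: segment_compact.
have [M [_ gM]] : bounded_set (g @` (`[-1 : R, 1]%classic `*` `[-1 : R, 1]%classic)).
  apply: (@compact_bounded _ R^o); apply: continuous_compact cK.
  exact: continuous_subspaceT.
exists (`|M| + 1) => [|s t st]; first by rewrite addr_ge0.
apply: (gM (`|M| + 1)); first by rewrite (le_lt_trans (ler_norm _)) ?ltrDl.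
by exists (s, t) => //; split; rewrite /= in_itv /=; nra.
Qed.

(** The projective line is covered by the closed unit discs of its two affine
    charts: in [a : b], divide by the coordinate of larger modulus. *)
Lemma continuous_bounded (psi : P1 R -> R) : continuous psi ->
  exists2 M : R, 0 <= M & forall x, `|psi x| <= M.
Proof.
move=> cpsi; pose w1 (p : R * R) : C * C := (p.1 +i* p.2, 1).
pose w2 (p : R * R) : C * C := (1, p.1 +i* p.2).
have cw1 : continuous w1.
  by move=> p; apply: (@cvg_pair _ _ _ _ (nbhs (p.1 +i* p.2 : C)) (nbhs (1 : C)));
    [exact: complex_continuous|exact: cvg_cst].
have cw2 : continuous w2.
  by move=> p; apply: (@cvg_pair _ _ _ _ (nbhs (1 : C)) (nbhs (p.1 +i* p.2 : C)));
    [exact: cvg_cst|exact: complex_continuous].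
have n1 p : w1 p != (0, 0) by rewrite xpair_eqE oner_eq0 andbF.
have n2 p : w2 p != (0, 0) by rewrite xpair_eqE oner_eq0.
have [M1 M1_ge0 h1] := bounded_on_square cpsi cw1 n1.
have [M2 M2_ge0 h2] := bounded_on_square cpsi cw2 n2.
have disc (z : C) : `|z| <= 1 -> complex.Re z ^+ 2 + complex.Im z ^+ 2 <= 1.
  move=> z1; have : `|z| ^+ 2 <= 1 by rewrite expr_le1.
  by rewrite -add_Re2_Im2 lecE /= => /andP[].
exists (M1 + M2) => [|x]; first exact: addr_ge0.
rewrite -[x]hcoordK; move: (hcoord_neq0 x); case: (hcoord x) => a b ab.
have [ba|ab'] := real_leP (normr_real a) (normr_real b).
  have b0 : b != 0.
    by apply: contra ab => /eqP b0; move: ba; rewrite b0 normr0 normr_le0 xpair_eqE => ->/=.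
  have -> : toP1 (a, b) = toP1 (w1 (complex.Re (a / b), complex.Im (a / b))).
    apply/(toP1_eq ab (n1 _)); exists b^-1; rewrite ?invr_neq0//.
    by rewrite /w1 /= mulVf// [b^-1 * a]mulrC; case: (a / b).
  apply: (le_trans (h1 _ _ _)); last by rewrite lerDl.
  by apply: disc; rewrite normf_div ler_pdivrMr ?normr_gt0// mul1r.
have a0 : a != 0 by rewrite -normr_gt0 (le_lt_trans _ ab').
have -> : toP1 (a, b) = toP1 (w2 (complex.Re (b / a), complex.Im (b / a))).
  apply/(toP1_eq ab (n2 _)); exists a^-1; rewrite ?invr_neq0//.
  by rewrite /w2 /= mulVf// [a^-1 * b]mulrC; case: (b / a).
apply: (le_trans (h2 _ _ _)); last by rewrite lerDr.
by apply: disc; rewrite normf_div ler_pdivrMr ?normr_gt0// mul1r ltW.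
Qed.

Lemma continuous_measurable_P1 (psi : P1 R -> R) : continuous psi ->
  measurable_fun setT (psi : borelP1 R -> R).
Proof.
move=> /continuousP cf; apply: (measurability _ (measurable_realfun.RGenOpens.measurableE R)).
move=> _ [_ [a [b ->] <-]]; rewrite setTI.
by apply: sub_gen_smallest; apply: cf; exact: interval_open.
Qed.

End Boundedness.

(** * Integrals against sums of Dirac masses *)

Section Integration.
Variable R : realType.
Implicit Types (g psi : P1 R -> R) (s : seq (P1 R)).

Import HBNNSimple.

(** The integral of a nonnegative function is a supremum over the simple functions
    below it, so the bound holds for every function g, measurable or not. In the
    application, g z is a sum over the preimages of z. *)
Lemma le_abs_Rintegral (dT : measure_display) (T : measurableType dT)
    (mu : {measure set T -> \bar R}) (g : T -> R) (M : R) :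
  mu setT = 1%E -> (forall x, `|g x| <= M) -> `|Rintegral mu setT g| <= M.
Proof.
move=> mu1 gM.
have bound (h : T -> \bar R) : (forall x, (0 <= h x)%E /\ (h x <= M%:E)%E) ->
    (0 <= integral mu setT h)%E /\ (integral mu setT h <= M%:E)%E.
  move=> hM; split; first by apply: integral_ge0 => x _; case: (hM x).
  rewrite ge0_integralTE; last by move=> x; case: (hM x).
  apply: ge_ereal_sup => _ [k /= kh <-]; rewrite -integralT_nnsfun.
  apply: (@le_trans _ _ (integral mu setT (cst M%:E))); last first.
    by rewrite integral_cst// mu1 mule1.
  apply: ge0_le_integral => //.
  - by move=> x _; rewrite lee_fin.
  - exact/measurable_EFinP.
  - by move=> x _; apply: le_trans (kh x) _; case: (hM x).
have /bound[p0 pM] x : (0 <= (EFin \o g)^\+ x)%E /\ ((EFin \o g)^\+ x <= M%:E)%E.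
  have := gM x; rewrite ler_norml => /andP[_ gx].
  by rewrite funepos_ge0 funeposE/= ge_max !lee_fin gx (le_trans _ (gM x)).
have /bound[n0 nM] x : (0 <= (EFin \o g)^\- x)%E /\ ((EFin \o g)^\- x <= M%:E)%E.
  have := gM x; rewrite ler_norml lerNl => /andP[gx _].
  by rewrite funeneg_ge0 funenegE/= ge_max !lee_fin gx (le_trans _ (gM x)).
rewrite /Rintegral integralE; move: p0 pM n0 nM.
case: (integral mu setT _) => [a| |] //; case: (integral mu setT _) => [b| |] //.
by rewrite !lee_fin /= ler_norml => *; lra.
Qed.

Lemma integral_mscale_dirac_sum (c : {nonneg R}) s g :
  measurable_fun setT (g : borelP1 R -> R) -> (forall x, 0 <= g x) ->
  (\int[mscale c (dirac_sum s)]_x (g x)%:E = (c%:num * \sum_(x <- s) g x)%:E)%E.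
Proof.
move=> mg g0; have mg' : measurable_fun setT (EFin \o g : borelP1 R -> \bar R).
  exact/measurable_EFinP.
rewrite ge0_integral_mscale//; last by move=> x _; rewrite lee_fin.
rewrite EFinM; congr (_ * _)%E.
rewrite ge0_integral_measure_sum//; last by move=> x _; rewrite lee_fin.
rewrite (big_nth point) big_mkord -sumEFin; apply: eq_bigr => i _.
by rewrite integral_dirac// diracT mul1e.
Qed.

Definition weighted_sums (c : nat -> R) (u : nat -> seq (P1 R)) (n : nat) g : R :=
  \sum_(k < n) c k * \sum_(x <- u k) g x.

Lemma weighted_sums0 c u g : weighted_sums c u 0 g = 0.
Proof. by rewrite /weighted_sums big_ord0. Qed.

Lemma weighted_sumsS c u n g :
  weighted_sums c u n.+1 g = weighted_sums c u n g + c n * \sum_(x <- u n) g x.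
Proof. by rewrite /weighted_sums big_ord_recr. Qed.

Lemma weighted_sumsB c u n g psi : weighted_sums c u n (fun x => g x - psi x) =
  weighted_sums c u n g - weighted_sums c u n psi.
Proof.
rewrite /weighted_sums -sumrB; apply: eq_bigr => k _.
by rewrite -mulrBr sumrB.
Qed.

Lemma le_weighted_sums c u n g (B : R) : (forall k, 0 <= c k) -> (forall x, g x <= B) ->
  weighted_sums c u n g <= B * weighted_sums c u n (fun=> 1).
Proof.
move=> c0 gB; rewrite /weighted_sums mulr_sumr; apply: ler_sum => k _.
rewrite mulrCA ler_wpM2l// mulr_sumr; apply: ler_sum => x _.
by rewrite mulr1.
Qed.

(** For nonnegative g, the partial sums always converge to the integral in the
    extended reals; the bound on the total mass makes the limit finite. *)
Lemma cvg_weighted_sums_ge0 (c : nat -> {nonneg R}) u g (B : R) :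
  (forall n, weighted_sums (fun k => (c k)%:num) u n (fun=> 1) <= 1) ->
  measurable_fun setT (g : borelP1 R -> R) -> (forall x, 0 <= g x <= B) ->
  let nu : {measure set (borelP1 R) -> \bar R} :=
    mseries (fun k => mscale (c k) (dirac_sum (u k))) 0 in
  (\int[nu]_x (g x)%:E < +oo)%E /\
  (weighted_sums (fun k => (c k)%:num) u n g @[n --> \oo] --> (\int[nu]_x g x)%R).
Proof.
move=> mass mg gB nu; pose T n := weighted_sums (fun k => (c k)%:num) u n g.
have g0 x : 0 <= g x by have /andP[] := gB x.
have mg' : measurable_fun setT (EFin \o g : borelP1 R -> \bar R).
  exact/measurable_EFinP.
have TE : (fun n => (T n)%:E) =
    (fun n => \sum_(0 <= k < n) \int[mscale (c k) (dirac_sum (u k))]_x (g x)%:E)%E.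
  apply/funext => n; rewrite big_mkord /T /weighted_sums -sumEFin.
  by apply: eq_bigr => k _; rewrite integral_mscale_dirac_sum.
have I0 k : (0 <= \int[mscale (c k) (dirac_sum (u k))]_x (g x)%:E)%E.
  by apply: integral_ge0 => x _; rewrite lee_fin.
have cT : ((T n)%:E @[n --> \oo] --> \int[nu]_x (g x)%:E)%E.
  rewrite TE /nu ge0_integral_measure_series//; last by move=> x _; rewrite lee_fin.
  by apply: is_cvg_nneseries.
have IB : (\int[nu]_x (g x)%:E <= B%:E)%E.
  rewrite -(cvg_lim _ cT)//; apply: lime_le; first by apply/cvg_ex; eexists; exact: cT.
  apply: nearW => n; rewrite lee_fin /T.
  apply: (le_trans (@le_weighted_sums _ _ _ _ B _ _)) => [k|x|]; [by []|by have /andP[] := gB x|].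
  have B0 : 0 <= B by have /andP[/le_trans] := gB point; apply.
  by rewrite -[leRHS]mulr1 ler_wpM2l.
clearbody nu.
have Ifin : (\int[nu]_x (g x)%:E)%E \is a fin_num.
  rewrite ge0_fin_numE; first exact: le_lt_trans IB (ltry _).
  by apply: integral_ge0 => x _; rewrite lee_fin.
split; first exact: le_lt_trans IB (ltry _).
by move: cT; rewrite -(fineK Ifin) => /fine_cvg; exact.
Qed.

(** For psi bounded by M, write psi as the difference of the nonnegative functions
    psi + M and M. *)
Lemma cvg_Rintegral_signed (nu : {measure set (borelP1 R) -> \bar R})
    (T : nat -> (P1 R -> R) -> R) psi :
  (forall n g h, T n (fun x => g x - h x) = T n g - T n h) ->
  (forall g B, measurable_fun setT (g : borelP1 R -> R) -> (forall x, 0 <= g x <= B) ->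
    (\int[nu]_x (g x)%:E < +oo)%E /\ T n g @[n --> \oo] --> (\int[nu]_x g x)%R) ->
  continuous psi -> T n psi @[n --> \oo] --> (\int[nu]_x psi x)%R.
Proof.
move=> TB Tge0 cpsi; have [M M0 psiM] := continuous_bounded cpsi.
have mpsi := continuous_measurable_P1 cpsi.
pose g x := psi x + M; pose h (_ : P1 R) : R := M.
have mg : measurable_fun setT (g : borelP1 R -> R) by exact: measurable_funD.
have mh : measurable_fun setT (h : borelP1 R -> R) by exact: measurable_cst.
have psiE : psi = (fun x => g x - h x) by apply/funext => x; rewrite /g /h addrK.
have gb x : 0 <= g x <= M + M.
  by have := psiM x; rewrite ler_norml /g => /andP[]; lra.
have hb x : 0 <= h x <= M by rewrite M0 lexx.
have [Ig Tg] := Tge0 g _ mg gb; have [Ih Th] := Tge0 h _ mh hb.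
have int k B : measurable_fun setT (k : borelP1 R -> R) -> (forall x, 0 <= k x <= B) ->
    (\int[nu]_x (k x)%:E < +oo)%E -> nu.-integrable setT (EFin \o k).
  move=> mk kB Ik; apply/integrableP; split; first exact/measurable_EFinP.
  under eq_integral => x _ do rewrite /= ger0_norm ?(andP (kB x)).1//.
  exact: Ik.
have -> : (\int[nu]_x psi x = \int[nu]_x g x - \int[nu]_x h x)%R.
  rewrite psiE; apply: RintegralB => //; first exact: int mg gb Ig.
  exact: int mh hb Ih.
have -> : T^~ psi = (fun n => T n g - T n h) by apply/funext => n; rewrite psiE TB.
exact: cvgB.
Qed.

End Integration.

(** * Iterates of a degenerate map *)

Section Iterates.
Variables (R : realType) (d m e : nat) (f : bipoly R * bipoly R).
Local Notation C := R[i].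
Local Notation bpoly := (bipoly R).
Implicit Types (g psi : P1 R -> R) (x y h : P1 R).
Let H := Hpart f.
Let F := phipair f.
Hypotheses (m_gt0 : (0 < m)%N) (me : (m + e)%N = d) (H0 : H != 0) (hH : homogeneous m H).
Hypotheses (h1 : homogeneous e F.1) (h2 : homogeneous e F.2) (F0 : no_common_zero F).
Hypothesis fE : f = (H * F.1, H * F.2).
Hypothesis fI : forall c, (forall x, phi f x = c) -> c \notin holes f.

Let hn n : homogeneous (e ^ n) (iterate n F).1 /\ homogeneous (e ^ n) (iterate n F).2.
Proof. exact: homogeneous_iterate. Qed.

(** If the fibre form vanished, the n-th iterate of phi would be constant, equal to
    h. This is absurd when phi is not constant, hence surjective, and when n = 0;
    otherwise h is the constant value of phi, which is not a hole. *)
Lemma fibre_form_hole_neq0 n h : h \in holes f -> fibre_form (iterate n F) h != 0.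
Proof.
move=> hf; apply/eqP => h0.
have nh x : iter n (phi f) x = h.
  rewrite phiE -(mapP1_iterate _ _ h1 h2 F0) -value_fibre_form ?h0 ?value0//.
  exact: no_common_zero_iterate h1 h2 F0.
have [[c fc]|nc] := pselect (phi_constant f).
  case: n {h0} nh => [|n] nh.
    by have [x [y]] := P1_nontrivial R; apply; rewrite [x]nh [y]nh.
  by have /negP := fI fc; apply; rewrite -(fc (iter n (phi f) point)) -iterS nh.
have [x [y xy]] := P1_nontrivial R.
suff sj z : exists u, iter n (phi f) u = z.
  by have [[u ux] [v vy]] := (sj x, sj y); apply: xy; rewrite -ux -vy !nh.
elim: n z {h0 nh} => [|n IH] z; first by exists z.
have [|u uz] := @mapP1_surjective R e F h1 h2 F0 _ z; first by rewrite -phiE.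
by have [v vu] := IH u; exists v; rewrite iterS vu phiE.
Qed.

Definition new_holes n : seq (P1 R) :=
  flatten [seq preimages (iterate n F) h | h <- holes f].

Lemma splits_new_holes n : splits (subst (iterate n F) H) (new_holes n).
Proof.
have [hn1 hn2] := hn n; apply: splits_subst hn1 hn2 _ _; first exact: splits_zeros H0 hH.
by move=> h; exact: fibre_form_hole_neq0.
Qed.

(** The polynomial H_n with f^n = H_n (p_n, q_n); it is the product of
    the H(p_k, q_k) ^ (d ^ (n - k - 1)) over k < n. *)
Fixpoint hole_form n : bpoly :=
  if n is n'.+1 then hole_form n' ^+ d * subst (iterate n' F) H else 1.

Fixpoint iterated_holes n : seq (P1 R) :=
  if n is n'.+1 then flatten (nseq d (iterated_holes n')) ++ new_holes n' else [::].

Lemma splits_hole_form n : splits (hole_form n) (iterated_holes n).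
Proof.
elim: n => [|n IH] /=; first exact: splits1.
by apply: splitsM; [exact: splitsXn|exact: splits_new_holes].
Qed.

Lemma iterate_factor n : iterate n f =
  (hole_form n * (iterate n F).1, hole_form n * (iterate n F).2).
Proof.
have [hf1 hf2] : homogeneous d f.1 /\ homogeneous d f.2.
  by rewrite fE -me; split; exact: homogeneousM.
elim: n => [|n IH]; first by rewrite /= !mul1r.
rewrite iterateS composeE IH (subst_scale _ _ hf1) (subst_scale _ _ hf2).
rewrite [in X in (X, _)]fE [in X in (_, X)]fE iterateS composeE /=.
by rewrite !substM !mulrA.
Qed.

Lemma Hpart_iterate n : exists2 c : C, c != 0 &
  Hpart (iterate n f) = c *: hole_form n /\
  phipair (iterate n f) = (c^-1 *: (iterate n F).1, c^-1 *: (iterate n F).2).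
Proof.
have [hn1 hn2] := hn n; have sn := splits_hole_form n.
rewrite iterate_factor.
apply: Hpart_phipair (splits_neq0 sn) (splits_homogeneous sn) hn1 hn2 _.
by rewrite -surjective_pairing; exact: no_common_zero_iterate h1 h2 F0.
Qed.

Lemma holes_iterate n : perm_eq (holes (iterate n f)) (iterated_holes n).
Proof.
have [c c0 [HE _]] := Hpart_iterate n.
by rewrite /holes HE; apply/zeros_splits/splitsZ/splits_hole_form.
Qed.

Lemma size_preimages_iterate n y :
  (size (preimages (phipair (iterate n f)) y) <= e ^ n)%N.
Proof.
have [c c0 [_ ->]] := Hpart_iterate n; have [hn1 hn2] := hn n.
by apply: size_preimages; exact: homogeneousZ.
Qed.

Lemma size_holes : size (holes f) = m.
Proof.
apply/(mpoly.dhomog_uniq H0); last exact: hH.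
exact/splits_homogeneous/(splits_zeros H0 hH).
Qed.

Lemma size_new_holes n : (size (new_holes n) <= m * e ^ n)%N.
Proof.
have [hn1 hn2] := hn n; rewrite -size_holes /new_holes; elim: (holes f) => //= h s IH.
by rewrite size_cat mulSn leq_add// size_preimages.
Qed.

(** A preimage of a hole h under phi^(n+1) would make h the constant value of
    phi. *)
Lemma new_holes_constant n : phi_constant f -> new_holes n.+1 = [::].
Proof.
move=> [c fc]; rewrite /new_holes.
suff E h : h \in holes f -> preimages (iterate n.+1 F) h = [::].
  elim: (holes f) E => //= h s IH E; rewrite E ?mem_head//.
  by apply: IH => k ks; apply: E; rewrite in_cons ks orbT.
move=> hf; case E : preimages => [//|x s]; have [hn1 hn2] := hn n.+1.
have : x \in preimages (iterate n.+1 F) h by rewrite E mem_head.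
move/(mem_preimages _ hn1 hn2 (no_common_zero_iterate _ h1 h2 F0) (fibre_form_hole_neq0 _ hf)).
rewrite (mapP1_iterate _ _ h1 h2 F0) -phiE iterS fc => ch.
by have /negP[] := fI fc; rewrite ch.
Qed.

Lemma preimages_iterate0 y : perm_eq (preimages (iterate 0 F) y) [:: y].
Proof.
apply/zeros_splits; exists 1; rewrite ?oner_neq0//.
by rewrite scale1r /lprod big_seq1.
Qed.

Lemma new_holes0 : perm_eq (new_holes 0) (holes f).
Proof.
rewrite /new_holes; elim: (holes f) => //= h s IH.
by rewrite -cat1s; exact: perm_cat (preimages_iterate0 h) IH.
Qed.

Let d_gt0 : 0 < d%:R :> R.
Proof. by rewrite ltr0n -me ltn_addr. Qed.

Let d_neq0 : d%:R != 0 :> R.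
Proof. by rewrite gt_eqF. Qed.

Let T n (psi : P1 R -> R) :=
  weighted_sums (fun k => (d%:R ^+ k.+1)^-1) new_holes n psi.

(** Dividing by d ^ n turns the d copies of the old holes into the previous partial
    sum. *)
Lemma sum_holes_iterate n psi :
  (d%:R ^+ n)^-1 * (\sum_(h <- holes (iterate n f)) psi h) = T n psi.
Proof.
rewrite (perm_big _ (holes_iterate n))/=.
elim: n => [|n IH]; first by rewrite /T weighted_sums0 big_nil mulr0.
rewrite /T weighted_sumsS -/(T n psi) -IH big_cat/= mulrDr.
congr (_ + _); rewrite exprSr invfM -mulrA; congr (_ * _).
have -> : \sum_(x <- flatten (nseq d (iterated_holes n))) psi x =
    d%:R * \sum_(x <- iterated_holes n) psi x.
  elim: {1 2}d => [|k IHk]; first by rewrite big_nil mul0r.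
  by rewrite /= big_cat /= IHk -natr1 mulrDl mul1r addrC.
by rewrite mulKf// gt_eqF.
Qed.

(** Since there are at most m e ^ k new holes and m = d - e, the sum telescopes. *)
Lemma mass_le1 n : T n (fun=> 1) <= 1.
Proof.
apply: (@le_trans _ _ (1 - (e%:R / d%:R) ^+ n)); last first.
  by rewrite gerBl exprn_ge0// divr_ge0// ltW.
elim: n => [|n IH]; first by rewrite /T weighted_sums0 expr0 subrr.
rewrite /T weighted_sumsS -/(T n _).
have s1 : \sum_(x <- new_holes n) 1 <= m%:R * e%:R ^+ n :> R.
  rewrite big_const_seq count_predT iter_addr_0 -natrX -natrM ler_nat.
  exact: size_new_holes.
apply: (le_trans (lerD IH (ler_wpM2l _ s1))).
  by rewrite invr_ge0 exprn_ge0// ltW.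
have mE : m%:R = d%:R - e%:R :> R by rewrite -me natrD addrK.
have -> : (d%:R ^+ n.+1)^-1 * (m%:R * e%:R ^+ n) =
    (1 - e%:R / d%:R) * (e%:R / d%:R) ^+ n :> R.
  rewrite expr_div_n exprS mE; field.
  by rewrite d_neq0 expf_neq0.
by rewrite exprSr mulrBl mul1r [_ / _ * _]mulrC addrA subrK.
Qed.

Lemma weighted_sums_constant n g : phi_constant f ->
  T n.+1 g = d%:R^-1 * \sum_(h <- holes f) g h.
Proof.
move=> fc; elim: n => [|n IH]; rewrite /T weighted_sumsS.
  rewrite weighted_sums0 add0r expr1; congr (_ * _).
  exact: (perm_big _ new_holes0).
rewrite -/(T n.+1 g) IH (new_holes_constant _ fc).
by rewrite big_nil mulr0 addr0.
Qed.

Lemma cvg_weighted_sums psi : continuous psi ->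
  T n psi @[n --> \oo] --> (\int[mu_of d f]_x psi x)%R.
Proof.
move=> cpsi; rewrite /mu_of; case: asboolP => [fc|nc].
  apply: cvg_Rintegral_signed => // [n g h|g B mg gB]; first exact: weighted_sumsB.
  have g0 x : 0 <= g x by have /andP[] := gB x.
  rewrite /Rintegral /mu_constant integral_mscale_dirac_sum//=; split; first exact: ltry.
  rewrite -cvg_shiftS; apply: cvg_near_cst; apply: nearW => n.
  exact: weighted_sums_constant.
apply: cvg_Rintegral_signed => // [n g h|g B mg gB]; first exact: weighted_sumsB.
exact: (@cvg_weighted_sums_ge0 _ (fun k => ((d%:R ^+ k.+1)^-1)%:nng)
  new_holes g B mass_le1 mg gB).
Qed.

(** The holes account for the partial sum; the remainder is the integral, over z,
    of psi summed over at most e ^ n preimages of z. *)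
Lemma pullback_iterate_remainder (mu : probability (borelP1 R) R) psi (M : R) n :
  0 <= M -> (forall x, `|psi x| <= M) ->
  `|(d%:R ^+ n)^-1 * pullback (d ^ n) (iterate n f) mu psi - T n psi|
    <= M * (e%:R / d%:R) ^+ n.
Proof.
move=> M0 psiM; rewrite -sum_holes_iterate /pullback mulrDr addrK normrM.
have dn0 : 0 < d%:R ^+ n :> R by rewrite exprn_gt0.
rewrite ger0_norm; last by rewrite invr_ge0 ltW.
rewrite mulrC expr_div_n mulrA.
apply: ler_wpM2r; first by rewrite invr_ge0 ltW.
case: ifPn => _; last by rewrite normr0 mulr_ge0 ?exprn_ge0.
apply: le_abs_Rintegral; first exact: probability_setT.
move=> z; apply: (le_trans (ler_norm_sum _ _ _)).
apply: (@le_trans _ _ (\sum_(y <- preimages (phipair (iterate n f)) z) M)).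
  by apply: ler_sum => y _; exact: psiM.
rewrite big_const_seq count_predT iter_addr_0 -[M *+ _]mulr_natr ler_wpM2l// -natrX ler_nat.
exact: size_preimages_iterate.
Qed.

Lemma weakly_cvg_pullback (mu : probability (borelP1 R) R) :
  weakly_cvg
    (fun n psi => (d%:R ^+ n)^-1 * pullback (d ^ n) (iterate n f) mu psi)
    (mu_of d f).
Proof.
move=> psi cpsi; have [M M0 psiM] := continuous_bounded cpsi.
pose L n := (d%:R ^+ n)^-1 * pullback (d ^ n) (iterate n f) mu psi.
suff : T n psi + (L n - T n psi) @[n --> \oo] --> (\int[mu_of d f]_x psi x)%R.
  by under eq_fun do rewrite addrC subrK.
rewrite -[X in _ --> X]addr0; apply: cvgD; first exact: cvg_weighted_sums.
apply/norm_cvg0P.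
have : M * (e%:R / d%:R) ^+ n @[n --> \oo] --> (0 : R).
  apply: cvg_geometric; rewrite ger0_norm ?divr_ge0 ?ler0n//.
  by rewrite ltr_pdivrMr// mul1r ltr_nat -me -[X in (X < _)%N]add0n ltn_add2r.
apply: (@squeeze_cvgr _ _ _ _ (cst 0)); last exact: cvg_cst.
by apply: nearW => n; rewrite normr_ge0 /=; exact: pullback_iterate_remainder.
Qed.

End Iterates.

Theorem proposition10 (R : realType) (d : nat) (f : bipoly R * bipoly R)
    (mu : probability (borelP1 R) R) :
  (2 <= d)%N -> ratbar d f -> degenerate f -> ~ indeterminate f ->
  weakly_cvg
    (fun n psi => (d%:R ^+ n)^-1 * pullback (d ^ n) (iterate n f) mu psi)
    (mu_of d f).
Proof.
move=> _ rf df nI; have [m [e [me H0 hH [h1 h2 F0 fE]]]] := ratbarP rf.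
have fI c : (forall x, phi f x = c) -> c \notin holes f.
  by move=> fc; apply/negP => ch; apply: nI; split=> //; exists c.
apply: (weakly_cvg_pullback _ me) => //; apply: (degenerate_Hpart H0 hH _ df).
rewrite {1 2}fE /=; apply: (is_gcd_no_common_zero H0 hH h1 h2).
by rewrite -surjective_pairing.
Qed.
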